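(* Let $C$ be a coalgebra over a field $k$, let $C^*=\mathrm{Hom}_k(C,k)$ be its dual algebra, and let $M$ and $N$ be left $C$-comodules. Then: (1) $N$ is $M$-Rickart (in the category ${}^C\mathcal{M}$ of left $C$-comodules) if and only if $N$ is $M$-Rickart as a right $C^*$-module. (2) $N$ is dual $M$-Rickart (in ${}^C\mathcal{M}$) if and only if $N$ is dual $M$-Rickart as a right $C^*$-module.
   Context: For objects $M,N$ of an abelian category, $N$ is called $M$-Rickart if for every morphism $f:M\to N$, $\mathrm{Ker}(f)$ is a direct summand of $M$ (i.e. $\mathrm{Ker}(f)\to M$ is a split monomorphism); $N$ is called dual $M$-Rickart if for every morphism $f:M\to N$, $\mathrm{Im}(f)$ is a direct summand of $N$ (i.e. $N\to\mathrm{Coker}(f)$ is a split epimorphism). $C^*$ is an algebra under convolution. Left $C$-comodules are identified with rational right $C^*$-modules: a left $C$-comodule $M$ with coaction $m\mapsto \sum m_{(-1)}\otimes m_{(0)}$ is a right $C^*$-module via $m\cdot f=\sum f(m_{(-1)})m_{(0)}$. ''As a right $C^*$-module'' means that $M$ and $N$ are regarded as objects of $\mathrm{Mod}(C^* )$, the category of all right $C^*$-modules. *)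

(* Defs.v *)
From HB Require Import structures.
From mathcomp Require Import all_boot all_algebra.
From mathcomp Require Import boolp.

Set Implicit Arguments.
Unset Strict Implicit.
Unset Printing Implicit Defensive.

Import GRing.Theory.
Local Open Scope ring_scope.
Local Open Scope quotient_scope.

(* Relative (dual) Rickart objects only involve kernels, cokernels and split
   morphisms, so they are defined in any category with zero morphisms.        *)
Record category := Category {
  obj :> Type;
  hom : obj -> obj -> Type;
  idm : forall X, hom X X;
  mcomp : forall X Y Z, hom Y Z -> hom X Y -> hom X Z;
  zerom : forall X Y, hom X Y;
  compA : forall X Y Z T (h : hom Z T) (g : hom Y Z) (f : hom X Y),
    mcomp h (mcomp g f) = mcomp (mcomp h g) f;
  comp1m : forall X Y (f : hom X Y), mcomp (idm Y) f = f;
  compm1 : forall X Y (f : hom X Y), mcomp f (idm X) = f;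
  comp0m : forall X Y Z (f : hom X Y), mcomp (zerom Y Z) f = zerom X Z;
  compm0 : forall X Y Z (g : hom Y Z), mcomp g (zerom X Y) = zerom X Z
}.

Section Rickart.
Variable A : category.

Definition is_kernel (M N K : A) (f : hom M N) (i : hom K M) : Prop :=
  mcomp f i = zerom K N /\
  forall (X : A) (g : hom X M), mcomp f g = zerom X N ->
    exists! h : hom X K, mcomp i h = g.

Definition is_cokernel (M N Q : A) (f : hom M N) (q : hom N Q) : Prop :=
  mcomp q f = zerom M Q /\
  forall (X : A) (g : hom N X), mcomp g f = zerom M X ->
    exists! h : hom Q X, mcomp h q = g.

Definition split_mono (X Y : A) (i : hom X Y) : Prop :=
  exists r : hom Y X, mcomp r i = idm X.

Definition split_epi (X Y : A) (q : hom X Y) : Prop :=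
  exists s : hom Y X, mcomp q s = idm Y.

(* [rickart M N] : N is M-Rickart. Kernels are unique up to isomorphism, so it
   does not matter which one is required to split.                            *)
Definition rickart (M N : A) : Prop :=
  forall f : hom M N, exists (K : A) (i : hom K M),
    is_kernel f i /\ split_mono i.

(* [dual_rickart M N] : N is dual M-Rickart. That Im f is a direct summand of N
   is expressed by N -> Coker f being a split epimorphism.                    *)
Definition dual_rickart (M N : A) : Prop :=
  forall f : hom M N, exists (Q : A) (q : hom N Q),
    is_cokernel f q /\ split_epi q.

End Rickart.

(* U (x) V is the set of formal sums of pairs (x, y), i.e. finite lists of
   pairs, modulo the congruence generated by commutativity and the bilinear
   relations.                                                                 *)
Section Tensor.
Variables (k : fieldType) (U V : lmodType k).

Inductive tens_cong : seq (U * V) -> seq (U * V) -> Prop :=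
| TensRefl s : tens_cong s s
| TensSym s t : tens_cong s t -> tens_cong t s
| TensTrans s t u : tens_cong s t -> tens_cong t u -> tens_cong s u
| TensCat s s' t t' :
    tens_cong s s' -> tens_cong t t' -> tens_cong (s ++ t) (s' ++ t')
| TensComm s t : tens_cong (s ++ t) (t ++ s)
| TensZero y : tens_cong [:: (0, y)] [::]
| TensAddl x x' y : tens_cong [:: (x + x', y)] [:: (x, y); (x', y)]
| TensAddr x y y' : tens_cong [:: (x, y + y')] [:: (x, y); (x, y')]
| TensScale a x y : tens_cong [:: (a *: x, y)] [:: (x, a *: y)].

Definition tens_rel : rel (seq (U * V)) := fun s t => `[< tens_cong s t >].

Fact tens_rel_equiv : equiv_class_of tens_rel.
Proof.
split=> [s|s t|t s u].
- by apply/asboolP/TensRefl.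
- by apply/asboolP/asboolP; apply: TensSym.
- by move=> /asboolP st /asboolP tu; apply/asboolP; apply: TensTrans st tu.
Qed.

Canonical tens_equiv_rel := EquivRelPack tens_rel_equiv.

Definition tens := {eq_quot tens_equiv_rel}.
HB.instance Definition _ := Choice.on tens.
HB.instance Definition _ := EqQuotient.on tens.

Definition tens_pi (s : seq (U * V)) : tens := \pi_tens s.
Definition tensor (x : U) (y : V) : tens := tens_pi [:: (x, y)].

Lemma tens_piP s t : tens_pi s = tens_pi t <-> tens_cong s t.
Proof.
split=> [/eqP|st]; last by apply/eqP; rewrite eqmodE; apply/asboolP.
by rewrite eqmodE => /asboolP.
Qed.

Lemma tens_pi_repr z : tens_pi (repr z) = z.
Proof. exact: reprK. Qed.

Lemma tens_repr_pi s : tens_cong (repr (tens_pi s)) s.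
Proof. by apply/tens_piP; rewrite tens_pi_repr. Qed.

Definition tens_scale_seq (a : k) (s : seq (U * V)) : seq (U * V) :=
  [seq (a *: p.1, p.2) | p <- s].

Lemma tens_cong_scale a s t :
  tens_cong s t -> tens_cong (tens_scale_seq a s) (tens_scale_seq a t).
Proof.
elim=> {s t} [s|s t _|s t u _ IH1 _ IH2|s s' t t' _ IH1 _ IH2|s t
  |y|x x' y|x y y'|b x y].
- exact: TensRefl.
- exact: TensSym.
- exact: TensTrans IH1 IH2.
- by rewrite /tens_scale_seq !map_cat; apply: TensCat.
- by rewrite /tens_scale_seq !map_cat; apply: TensComm.
- by rewrite /= scaler0; apply: TensZero.
- by rewrite /= scalerDr; apply: TensAddl.
- exact: TensAddr.
- by rewrite /= scalerA mulrC -scalerA; apply: TensScale.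
Qed.

Definition tens_add (z w : tens) : tens := tens_pi (repr z ++ repr w).
Definition tens_zero : tens := tens_pi [::].
Definition tens_scale (a : k) (z : tens) : tens :=
  tens_pi (tens_scale_seq a (repr z)).
Definition tens_opp (z : tens) : tens := tens_scale (-1) z.

Lemma tens_pi_cat s t : tens_pi (s ++ t) = tens_add (tens_pi s) (tens_pi t).
Proof. by apply/tens_piP/TensSym/TensCat; apply: tens_repr_pi. Qed.

Lemma tens_pi_scale a s :
  tens_pi (tens_scale_seq a s) = tens_scale a (tens_pi s).
Proof. by apply/tens_piP/TensSym/tens_cong_scale/tens_repr_pi. Qed.

Lemma tens_cong_scaleDl a b s :
  tens_cong (tens_scale_seq (a + b) s)
            (tens_scale_seq a s ++ tens_scale_seq b s).
Proof.
elim: s => [|[x y] s IHs] /=; first exact: TensRefl.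
rewrite scalerDl.
apply: (@TensTrans _ ([:: (a *: x, y); (b *: x, y)] ++
                      (tens_scale_seq a s ++ tens_scale_seq b s))).
  by rewrite -cat1s; apply: TensCat => //; apply: TensAddl.
have: tens_cong ([:: (a *: x, y)] ++
    ([:: (b *: x, y)] ++ tens_scale_seq a s) ++ tens_scale_seq b s)
  ([:: (a *: x, y)] ++
    (tens_scale_seq a s ++ [:: (b *: x, y)]) ++ tens_scale_seq b s).
  apply: TensCat; first exact: TensRefl.
  by apply: TensCat; [apply: TensComm | apply: TensRefl].
by rewrite -[in X in tens_cong _ X]catA.
Qed.

Lemma tens_addA : associative tens_add.
Proof.
move=> z w v; rewrite -[z]tens_pi_repr -[w]tens_pi_repr -[v]tens_pi_repr.
by rewrite -!tens_pi_cat catA.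
Qed.

Lemma tens_addC : commutative tens_add.
Proof. by move=> z w; apply/tens_piP/TensComm. Qed.

Lemma tens_add0 : left_id tens_zero tens_add.
Proof. by move=> z; rewrite -[z]tens_pi_repr -tens_pi_cat. Qed.

Lemma tens_scale1 : left_id 1 tens_scale.
Proof.
move=> z; rewrite -[z]tens_pi_repr -tens_pi_scale; congr tens_pi.
by rewrite -[RHS]map_id; apply: eq_map => -[x y] /=; rewrite scale1r.
Qed.

Lemma tens_scale0 z : tens_scale 0 z = tens_zero.
Proof.
rewrite -[z]tens_pi_repr -tens_pi_scale; apply/tens_piP.
elim: (repr z) => [|[x y] s IHs]; first exact: TensRefl.
rewrite /= scale0r -cat1s -[X in tens_cong _ X]cat0s.
by apply: TensCat => //; apply: TensZero.
Qed.

Lemma tens_scaleDl z a b :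
  tens_scale (a + b) z = tens_add (tens_scale a z) (tens_scale b z).
Proof.
rewrite -[z]tens_pi_repr -!tens_pi_scale -tens_pi_cat.
exact/tens_piP/tens_cong_scaleDl.
Qed.

Lemma tens_addN : left_inverse tens_zero tens_opp tens_add.
Proof.
move=> z; rewrite /tens_opp -{2}[z]tens_scale1 -tens_scaleDl addNr.
exact: tens_scale0.
Qed.

HB.instance Definition _ :=
  GRing.isZmodule.Build tens tens_addA tens_addC tens_add0 tens_addN.

Lemma tens_scaleA a b z : tens_scale a (tens_scale b z) = tens_scale (a * b) z.
Proof.
rewrite -[z]tens_pi_repr -!tens_pi_scale; congr tens_pi.
by rewrite /tens_scale_seq -map_comp; apply: eq_map => p /=; rewrite scalerA.
Qed.

Lemma tens_scaleDr : right_distributive tens_scale +%R.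
Proof.
move=> a z w; rewrite -[z]tens_pi_repr -[w]tens_pi_repr.
rewrite -[_ + _]tens_pi_cat -!tens_pi_scale /tens_scale_seq map_cat.
exact: tens_pi_cat.
Qed.

HB.instance Definition _ := GRing.Zmodule_isLmodule.Build k tens
  tens_scaleA tens_scale1 tens_scaleDr tens_scaleDl.

Lemma tens_piD s t : tens_pi (s ++ t) = tens_pi s + tens_pi t.
Proof. exact: tens_pi_cat. Qed.

Lemma tens_piZ a s : tens_pi (tens_scale_seq a s) = a *: tens_pi s.
Proof. exact: tens_pi_scale. Qed.

Lemma tensor_bilinear : bilinear_for *:%R *:%R tensor.
Proof.
split=> [y|x] a u v; rewrite /tensor /= -tens_piZ -tens_piD.
  exact/tens_piP/TensAddl.
apply/tens_piP/(TensTrans (TensAddr _ _ _)).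
apply: (@TensCat [:: _] [:: _] [:: _] [:: _]); last exact: TensRefl.
exact/TensSym/TensScale.
Qed.

Lemma tens_pi_sum s : tens_pi s = \sum_(p <- s) tensor p.1 p.2.
Proof.
elim: s => [|[x y] s IHs]; first by rewrite big_nil.
by rewrite big_cons -IHs -cat1s tens_piD.
Qed.

(* If z is the sum of the x_i (x) y_i then [tens_lift b z] is the sum of the
   b x_i y_i. This does not depend on the decomposition of z (and is then the
   linear map given by the universal property) as soon as b is bilinear; it is
   used with bilinear b only.                                                 *)
Definition tens_lift (W : lmodType k) (b : U -> V -> W) (z : tens) : W :=
  \sum_(p <- repr z) b p.1 p.2.

Section Lift.
Variables (W : lmodType k) (b : U -> V -> W).
Hypothesis bilin : bilinear_for *:%R *:%R b.

Let bDl x x' y : b (x + x') y = b x y + b x' y.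
Proof. by have /= := bilin.1 y 1 x x'; rewrite !scale1r. Qed.

Let bDr x y y' : b x (y + y') = b x y + b x y'.
Proof. by have /= := bilin.2 x 1 y y'; rewrite !scale1r. Qed.

Let b0l y : b 0 y = 0.
Proof. by apply: (@addrI _ (b 0 y)); rewrite -bDl !addr0. Qed.

Let b0r x : b x 0 = 0.
Proof. by apply: (@addrI _ (b x 0)); rewrite -bDr !addr0. Qed.

Let bZl a x y : b (a *: x) y = a *: b x y.
Proof. by have /= := bilin.1 y a x 0; rewrite !addr0 b0l addr0. Qed.

Let bZr a x y : b x (a *: y) = a *: b x y.
Proof. by have /= := bilin.2 x a y 0; rewrite !addr0 b0r addr0. Qed.

Lemma tens_lift_pi s : tens_lift b (tens_pi s) = \sum_(p <- s) b p.1 p.2.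
Proof.
suff bsum t u : tens_cong t u ->
    \sum_(p <- t) b p.1 p.2 = \sum_(p <- u) b p.1 p.2.
  exact/bsum/tens_repr_pi.
elim=> {s t u} //= [s t u _ -> _ ->|s s' t t' _ h1 _ h2|s t
  |y|x x' y|x y y'|a x y] //.
- by rewrite !big_cat /= h1 h2.
- by rewrite !big_cat /= addrC.
- by rewrite big_seq1 big_nil.
- by rewrite big_seq1 big_cons big_seq1 /= bDl.
- by rewrite big_seq1 big_cons big_seq1 /= bDr.
- by rewrite !big_seq1 /= bZl bZr.
Qed.

Lemma tens_lift_tensor x y : tens_lift b (tensor x y) = b x y.
Proof. by rewrite tens_lift_pi big_seq1. Qed.

Lemma tens_lift_linear : linear (tens_lift b).
Proof.
move=> a z w; rewrite -[z]tens_pi_repr -[w]tens_pi_repr -tens_piZ.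
rewrite -tens_piD !tens_lift_pi big_cat big_map scaler_sumr /=.
by congr (_ + _); apply: eq_bigr => p _; rewrite /= bZl.
Qed.

End Lift.

Lemma tens_lift_ext (W : lmodType k) (b b' : U -> V -> W) z :
  (forall x y, b x y = b' x y) -> tens_lift b z = tens_lift b' z.
Proof. by move=> bb'; apply: eq_bigr => p _. Qed.

Lemma linear_tens_lift (W W' : lmodType k) (L : {linear W -> W'})
    (b : U -> V -> W) z :
  L (tens_lift b z) = tens_lift (fun x y => L (b x y)) z.
Proof. exact: linear_sum. Qed.

Lemma tens_lift_id z : tens_lift tensor z = z.
Proof. by rewrite /tens_lift -tens_pi_sum tens_pi_repr. Qed.

Lemma tens_ext (W : lmodType k) (f g : {linear tens -> W}) :
  (forall x y, f (tensor x y) = g (tensor x y)) -> f =1 g.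
Proof.
move=> fg z; rewrite -[z]tens_lift_id !linear_tens_lift.
exact: tens_lift_ext.
Qed.

End Tensor.

Definition tens_map (k : fieldType) (U V U' V' : lmodType k)
    (f : U -> U') (g : V -> V') : tens U V -> tens U' V' :=
  tens_lift (fun x y => tensor (f x) (g y)).

Definition tens_assoc (k : fieldType) (U V W : lmodType k) :
    tens (tens U V) W -> tens U (tens V W) :=
  tens_lift (fun z w => tens_lift (fun x y => tensor x (tensor y w)) z).

Section TensorMaps.
Variable k : fieldType.

Definition tens_lift_lin (U V W : lmodType k) (b : U -> V -> W)
    (bilin : bilinear_for *:%R *:%R b) : {linear tens U V -> W} :=
  HB.pack (tens_lift b)
    (GRing.isLinear.Build k (tens U V) W *:%R (tens_lift b)
       (tens_lift_linear bilin)).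

Lemma tens_map_bilinear (U V U' V' : lmodType k)
    (f : {linear U -> U'}) (g : {linear V -> V'}) :
  bilinear_for *:%R *:%R (fun x y => tensor (f x) (g y)).
Proof.
split=> [y|x] a u v /=; rewrite linearP.
  exact: (tensor_bilinear U' V').1.
exact: (tensor_bilinear U' V').2.
Qed.

Lemma tens_map_tensor (U V U' V' : lmodType k)
    (f : {linear U -> U'}) (g : {linear V -> V'}) x y :
  tens_map f g (tensor x y) = tensor (f x) (g y).
Proof. exact: tens_lift_tensor (tens_map_bilinear f g) x y. Qed.

Lemma tens_assoc_bilinear1 (U V W : lmodType k) (w : W) :
  bilinear_for *:%R *:%R (fun (x : U) (y : V) => tensor x (tensor y w)).
Proof.
split=> [y|x] a u v /=; first exact: (tensor_bilinear _ _).1.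
by rewrite ((tensor_bilinear V W).1 w a u v) ((tensor_bilinear _ _).2 x).
Qed.

Lemma tens_assoc_bilinear (U V W : lmodType k) :
  bilinear_for *:%R *:%R (fun (z : tens U V) (w : W) =>
    tens_lift (fun x y => tensor x (tensor y w)) z).
Proof.
split=> [w|z] a u v /=.
  exact: (tens_lift_linear (tens_assoc_bilinear1 U V w) a u v).
rewrite /tens_lift scaler_sumr -big_split /=; apply: eq_bigr => p _.
by rewrite ((tensor_bilinear V W).2 p.2 a u v) ((tensor_bilinear _ _).2 p.1).
Qed.

Lemma tens_assoc_tensor (U V W : lmodType k) (x : U) (y : V) (w : W) :
  tens_assoc (tensor (tensor x y) w) = tensor x (tensor y w).
Proof.
rewrite /tens_assoc (tens_lift_tensor (@tens_assoc_bilinear U V W)).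
exact: (tens_lift_tensor (tens_assoc_bilinear1 U V w)).
Qed.

(* Sweedler forms of the two sides of coassociativity. *)
Lemma tens_map_sweedler (U V V' Z : lmodType k) (D : V -> V')
    (L : {linear tens U V' -> Z}) (t : tens U V) :
  L (tens_map idfun D t) = tens_lift (fun u y => L (tensor u (D y))) t.
Proof. exact: linear_tens_lift. Qed.

Lemma tens_assoc_sweedler (U' U V W Z : lmodType k) (D : U' -> tens U V)
    (L : {linear tens U (tens V W) -> Z}) (t : tens U' W) :
  L (tens_assoc (tens_map D idfun t)) =
  tens_lift (fun x w => tens_lift (fun u v => L (tensor u (tensor v w))) (D x))
    t.
Proof.
pose A := tens_lift_lin (@tens_assoc_bilinear U V W).
rewrite -[tens_assoc _]/(A _) [X in L X]linear_tens_lift linear_tens_lift.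
apply: tens_lift_ext => x w; rewrite -linear_tens_lift; congr (L _).
exact: (tens_lift_tensor (@tens_assoc_bilinear U V W)).
Qed.

End TensorMaps.

Record coalgebra (k : fieldType) := Coalgebra {
  coalg_space :> lmodType k;
  comul : {linear coalg_space -> tens coalg_space coalg_space};
  counit : {scalar coalg_space};
  comul_assoc : forall c,
    tens_assoc (tens_map comul idfun (comul c)) =
    tens_map idfun comul (comul c);
  counit_l : forall c, tens_lift (fun x y => counit x *: y) (comul c) = c;
  counit_r : forall c, tens_lift (fun x y => counit y *: x) (comul c) = c
}.

(* Left C-comodules. *)
Record comodule (k : fieldType) (C : coalgebra k) := Comodule {
  comod_space :> lmodType k;
  coact : {linear comod_space -> tens C comod_space};
  coact_assoc : forall m,
    tens_assoc (tens_map (comul C) idfun (coact m)) =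
    tens_map idfun coact (coact m);
  coact_counit : forall m,
    tens_lift (fun c x => counit C c *: x) (coact m) = m
}.

Lemma linear_eq (R : pzRingType) (U : lmodType R) (V : zmodType)
    (s : R -> V -> V) (f g : {linear U -> V | s}) : f =1 g -> f = g.
Proof.
case: f g => f cf [g cg] /= /funext fg; rewrite -{}fg in cg *.
congr GRing.Linear.Pack; move: cf cg => [[a] [b]] [[a'] [b']].
by rewrite (Prop_irrelevance a a') (Prop_irrelevance b b').
Qed.

Section DualAlgebra.
Variables (k : fieldType) (C : coalgebra k).

Definition dual_algebra := {scalar C}.

HB.instance Definition _ := gen_eqMixin dual_algebra.
HB.instance Definition _ := gen_choiceMixin dual_algebra.

Lemma dualP (f g : dual_algebra) : f =1 g -> f = g.
Proof. exact: linear_eq. Qed.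

Definition dual_pack (f : C -> k) (lf : linear_for *%R f) : dual_algebra :=
  HB.pack f (GRing.isLinear.Build k C k *%R f lf).

Fact dual_add_linear (f g : dual_algebra) : linear_for *%R (fun c => f c + g c).
Proof. by move=> a x y /=; rewrite !linearP mulrDr addrACA. Qed.
Fact dual_opp_linear (f : dual_algebra) : linear_for *%R (fun c => - f c).
Proof. by move=> a x y /=; rewrite linearP opprD mulrN. Qed.
Fact dual_zero_linear : linear_for *%R (fun c : C => 0 : k).
Proof. by move=> a x y /=; rewrite mulr0 addr0. Qed.

Definition dual_add (f g : dual_algebra) : dual_algebra :=
  dual_pack (dual_add_linear f g).
Definition dual_opp (f : dual_algebra) : dual_algebra :=
  dual_pack (dual_opp_linear f).
Definition dual_zero : dual_algebra := dual_pack dual_zero_linear.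

Fact dual_addA : associative dual_add.
Proof. by move=> f g h; apply: dualP => c /=; rewrite addrA. Qed.
Fact dual_addC : commutative dual_add.
Proof. by move=> f g; apply: dualP => c /=; rewrite addrC. Qed.
Fact dual_add0 : left_id dual_zero dual_add.
Proof. by move=> f; apply: dualP => c /=; rewrite add0r. Qed.
Fact dual_addN : left_inverse dual_zero dual_opp dual_add.
Proof. by move=> f; apply: dualP => c /=; rewrite addNr. Qed.

HB.instance Definition _ :=
  GRing.isZmodule.Build dual_algebra dual_addA dual_addC dual_add0 dual_addN.

Lemma dual_bilinear (M N : lmodType k) (f : dual_algebra)
    (L : {linear M -> N}) :
  bilinear_for *:%R *:%R (fun c x => f c *: L x).
Proof.
split=> [x|c] a u v /=; rewrite linearP.
  by rewrite scalerDl scalerA.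
by rewrite scalerDr !scalerA mulrC.
Qed.

(* (f * g) c = sum f(c_1) g(c_2) *)
Definition conv_fun (f g : dual_algebra) (c : C) : k :=
  tens_lift (fun x y => f x * g y : k^o) (comul C c).

Lemma conv_bilinear (f g : dual_algebra) :
  bilinear_for *:%R *:%R (fun x y => f x * g y : k^o).
Proof.
split=> [y|x] a u v /=; rewrite linearP; first by rewrite mulrDl -mulrA.
by rewrite mulrDr mulrCA.
Qed.

Fact conv_linear f g : linear_for *%R (conv_fun f g).
Proof.
move=> a x y; rewrite /conv_fun linearP.
exact: (tens_lift_linear (conv_bilinear f g)).
Qed.

Definition conv (f g : dual_algebra) : dual_algebra :=
  dual_pack (conv_linear f g).
Definition conv_one : dual_algebra := counit C.

Fact conv_assoc : associative conv.
Proof.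
move=> f g h; apply: dualP => c /=.
pose G := tens_lift_lin (conv_bilinear g h).
have bL : bilinear_for *:%R *:%R (fun x w => f x * G w : k^o).
  exact: (dual_bilinear f G).
pose L := tens_lift_lin bL.
have Lt x w : L (tensor x w) = f x * G w by exact: (tens_lift_tensor bL).
have Gt y z : G (tensor y z) = g y * h z.
  exact: (tens_lift_tensor (conv_bilinear g h)).
have := congr1 L (comul_assoc c).
rewrite tens_assoc_sweedler tens_map_sweedler => Lc.
transitivity (tens_lift (fun x y => L (tensor x (comul C y))) (comul C c)).
  by rewrite /conv_fun; apply: (@tens_lift_ext k C C k^o) => x y; rewrite Lt.
rewrite -{}Lc [RHS]/conv_fun; apply: (@tens_lift_ext k C C k^o) => x z.
rewrite -[conv f g x]/(conv_fun f g x) /conv_fun /tens_lift mulr_suml.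
apply: eq_bigr => p _.
by rewrite Lt Gt mulrA.
Qed.

Fact conv_1l : left_id conv_one conv.
Proof.
move=> f; apply: dualP => c /=.
rewrite -[in RHS](counit_l c) /conv_fun /tens_lift linear_sum /=.
by apply: eq_bigr => p _; rewrite linearZ.
Qed.

Fact conv_1r : right_id conv_one conv.
Proof.
move=> f; apply: dualP => c /=.
rewrite -[in RHS](counit_r c) /conv_fun /tens_lift linear_sum /=.
by apply: eq_bigr => p _; rewrite linearZ mulrC.
Qed.

Fact conv_Dl : left_distributive conv +%R.
Proof.
move=> f g h; apply: dualP => c /=.
rewrite /conv_fun /tens_lift -big_split /=.
by apply: eq_bigr => p _; rewrite mulrDl.
Qed.

Fact conv_Dr : right_distributive conv +%R.
Proof.
move=> f g h; apply: dualP => c /=.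
rewrite /conv_fun /tens_lift -big_split /=.
by apply: eq_bigr => p _; rewrite mulrDr.
Qed.

(* A [pzRingType], since C, hence its dual, may be zero. *)
HB.instance Definition _ := GRing.Zmodule_isPzRing.Build dual_algebra
  conv_assoc conv_1l conv_1r conv_Dl conv_Dr.

End DualAlgebra.

(* Right A-modules are left modules over the converse ring A^c. *)
Notation rmodType A := (lmodType A^c).

(* The right C^*-module structure m . f = sum f(m_(-1)) m_(0) of a left
   C-comodule M.                                                              *)
Section RationalModule.
Variables (k : fieldType) (C : coalgebra k) (M : comodule C).

Definition dual_act (m : M) (f : dual_algebra C) : M :=
  tens_lift (fun c x => f c *: x) (coact M m).

Definition rat_space : Type := M.
HB.instance Definition _ := GRing.Zmodule.on rat_space.

Definition rat_scale (f : (dual_algebra C)^c) (m : rat_space) : rat_space :=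
  dual_act m f.

Let act_bilinear (f : dual_algebra C) :
  bilinear_for *:%R *:%R (fun c (x : M) => f c *: x).
Proof. exact: (dual_bilinear f idfun). Qed.

Fact rat_scaleA f g m : rat_scale f (rat_scale g m) = rat_scale (f * g) m.
Proof.
pose F := tens_lift_lin (act_bilinear f).
have bL : bilinear_for *:%R *:%R (fun c w => (g : dual_algebra C) c *: F w).
  exact: (dual_bilinear g F).
pose L := tens_lift_lin bL.
have Lt c w : L (tensor c w) = (g : dual_algebra C) c *: F w.
  exact: (tens_lift_tensor bL).
have Ft c x : F (tensor c x) = (f : dual_algebra C) c *: x.
  exact: (tens_lift_tensor (act_bilinear f)).
have := congr1 L (coact_assoc m).
rewrite tens_assoc_sweedler tens_map_sweedler => Lm.
transitivity (tens_lift (fun c x => L (tensor c (coact M x))) (coact M m)).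
  rewrite /rat_scale /dual_act -[LHS]/(F (coact M _)).
  rewrite [X in F X]linear_tens_lift.
  rewrite linear_tens_lift; apply: tens_lift_ext => c x.
  by rewrite !linearZ Lt.
rewrite -{}Lm; apply: tens_lift_ext => c x.
rewrite [in RHS]/= /conv_fun [in RHS]/tens_lift scaler_suml.
by apply: eq_bigr => p _; rewrite Lt Ft scalerA.
Qed.

Fact rat_scale1 : left_id 1 rat_scale.
Proof. by move=> m; apply: coact_counit. Qed.

Fact rat_scaleDr : right_distributive rat_scale +%R.
Proof.
move=> f x y; rewrite /rat_scale /dual_act linearD.
exact: (linearD (tens_lift_lin (act_bilinear f))).
Qed.

Fact rat_scaleDl m : {morph rat_scale^~ m : f g / f + g}.
Proof.
move=> f g; rewrite /rat_scale /dual_act /tens_lift -big_split /=.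
by apply: eq_bigr => p _; rewrite scalerDl.
Qed.

HB.instance Definition _ :=
  GRing.Zmodule_isLmodule.Build (dual_algebra C)^c rat_space
  rat_scaleA rat_scale1 rat_scaleDr rat_scaleDl.

Definition rat_module : rmodType (dual_algebra C) := rat_space.

End RationalModule.

Section ModuleCategory.
Variable A : pzRingType.

Definition rmod_comp (M N P : rmodType A) (g : {linear N -> P})
  (f : {linear M -> N}) : {linear M -> P} := g \o f.
Definition rmod_zero (M N : rmodType A) : {linear M -> N} := \0.

Fact rmod_compA (M N P Q : rmodType A) (h : {linear P -> Q})
    (g : {linear N -> P}) (f : {linear M -> N}) :
  rmod_comp h (rmod_comp g f) = rmod_comp (rmod_comp h g) f.
Proof. exact: linear_eq. Qed.
Fact rmod_comp1m (M N : rmodType A) (f : {linear M -> N}) :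
  rmod_comp idfun f = f.
Proof. exact: linear_eq. Qed.
Fact rmod_compm1 (M N : rmodType A) (f : {linear M -> N}) :
  rmod_comp f idfun = f.
Proof. exact: linear_eq. Qed.
Fact rmod_comp0m (M N P : rmodType A) (f : {linear M -> N}) :
  rmod_comp (rmod_zero N P) f = rmod_zero M P.
Proof. exact: linear_eq. Qed.
Fact rmod_compm0 (M N P : rmodType A) (g : {linear N -> P}) :
  rmod_comp g (rmod_zero M N) = rmod_zero M P.
Proof. by apply: linear_eq => x; exact: linear0. Qed.

Definition rmod_category : category :=
  Category rmod_compA rmod_comp1m rmod_compm1 rmod_comp0m rmod_compm0.

End ModuleCategory.

Section ComoduleCategory.
Variables (k : fieldType) (C : coalgebra k).

Record comod_hom (M N : comodule C) := ComodHom {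
  comod_map :> {linear M -> N};
  comod_mapP : forall m,
    coact N (comod_map m) = tens_map idfun comod_map (coact M m)
}.

Lemma comod_hom_eq (M N : comodule C) (f g : comod_hom M N) : f =1 g -> f = g.
Proof.
case: f g => f cf [g cg] /= /linear_eq fg; rewrite -{}fg in cg *.
by rewrite (Prop_irrelevance cf cg).
Qed.

Fact comod_idP (M : comodule C) m :
  coact M m = tens_map idfun idfun (coact M m).
Proof. by rewrite /tens_map tens_lift_id. Qed.

Fact comod_compP (M N P : comodule C) (g : comod_hom N P) (f : comod_hom M N)
    m :
  coact P ((g \o f) m) = tens_map idfun (g \o f) (coact M m).
Proof.
rewrite /= comod_mapP comod_mapP.
rewrite [LHS](tens_map_sweedler _ (tens_lift_lin (tens_map_bilinear idfun g))).
apply: tens_lift_ext => c x.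
exact: (tens_lift_tensor (tens_map_bilinear idfun g)).
Qed.

Fact comod_zeroP (M N : comodule C) m :
  coact N ((\0 : M -> N) m) = tens_map idfun (\0 : M -> N) (coact M m).
Proof.
rewrite /= linear0 /tens_map /tens_lift big1 // => p _.
by have /= := (tensor_bilinear C N).2 p.1 (-1) 0 0;
  rewrite scaler0 addr0 scaleN1r addNr.
Qed.

Definition comod_id (M : comodule C) : comod_hom M M :=
  @ComodHom M M idfun (@comod_idP M).
Definition comod_comp (M N P : comodule C) (g : comod_hom N P)
  (f : comod_hom M N) : comod_hom M P :=
  @ComodHom M P (g \o f) (comod_compP g f).
Definition comod_zero (M N : comodule C) : comod_hom M N :=
  @ComodHom M N \0 (@comod_zeroP M N).

Fact comod_compA (M N P Q : comodule C) (h : comod_hom P Q)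
    (g : comod_hom N P) (f : comod_hom M N) :
  comod_comp h (comod_comp g f) = comod_comp (comod_comp h g) f.
Proof. exact: comod_hom_eq. Qed.
Fact comod_comp1m (M N : comodule C) (f : comod_hom M N) :
  comod_comp (comod_id N) f = f.
Proof. exact: comod_hom_eq. Qed.
Fact comod_compm1 (M N : comodule C) (f : comod_hom M N) :
  comod_comp f (comod_id M) = f.
Proof. exact: comod_hom_eq. Qed.
Fact comod_comp0m (M N P : comodule C) (f : comod_hom M N) :
  comod_comp (comod_zero N P) f = comod_zero M P.
Proof. exact: comod_hom_eq. Qed.
Fact comod_compm0 (M N P : comodule C) (g : comod_hom N P) :
  comod_comp g (comod_zero M N) = comod_zero M P.
Proof. by apply: comod_hom_eq => x; exact: linear0. Qed.

Definition comod_category : category :=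
  Category comod_compA comod_comp1m comod_compm1 comod_comp0m comod_compm0.

End ComoduleCategory.

(* Main.v *)
From HB Require Import structures.
From mathcomp Require Import all_boot all_algebra.
From mathcomp Require Import boolp classical_sets.
Require Import Defs.

(** Sending a left C-comodule to the corresponding rational right C^*-module is
    a functor which is fully faithful and preserves kernels and cokernels. Such
    a functor preserves and reflects relative Rickart objects
    ([fully_faithful_rickart]): kernels are unique up to isomorphism, so it does
    not matter which one is tested, and a fully faithful functor preserves and
    reflects split monomorphisms. Applied to the opposite categories, the same
    statement settles the dual notion.

    Faithfulness is clear. Fullness ([rat_hom_full]) says that a C^*-linear map
    g is colinear: both composites M -> C (x) N of the colinearity square have
    the same image under phi (x) N for all phi in C^*, and over a field these
    contractions separate the elements of C (x) N ([tens_contract_eq0]).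

    The kernel of a colinear f : M -> N must be computed by one and the same
    object in both categories, although the test objects for the second are
    arbitrary C^*-modules. For this it is enough that the set-theoretic kernel
    carries a comodule structure, and dually for the set-theoretic cokernel.
    Both are obtained from a k-linear map s with f s f = f, which exists by
    Zorn's lemma ([linear_pseudo_inverse]). The map 1 - s f projects M onto
    Ker f, and 1 - f s is a projection of N with kernel Im f. So the kernel and
    the cokernel are k-linear retracts K of a comodule, by maps i and p, and
    (C (x) p) rho i, with rho the coaction of the given comodule, is the desired
    coaction on K ([retract_comodule]). *)

Set Implicit Arguments.
Unset Strict Implicit.
Unset Printing Implicit Defensive.

Import GRing.Theory.
Local Open Scope ring_scope.

(** * Relative Rickart objects under fully faithful functors *)

Lemma kernel_split_mono (A : category) (M N K K' : A) (f : hom M N)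
    (i : hom K M) (j : hom K' M) :
  is_kernel f i -> is_kernel f j -> split_mono i -> split_mono j.
Proof.
move=> [fi0 iU] [fj0 jU] [r ri]; have [h [ih _]] := iU _ _ fj0.
have [h' [jh' _]] := jU _ _ fi0.
have [u [_ uU]] := jU _ _ fj0; exists (mcomp h' r).
rewrite -[RHS](uU _ (compm1 _)); symmetry; apply: uU.
by rewrite !compA jh' -ih -compA (compA r) ri comp1m.
Qed.

Section FullyFaithful.
Variables (A B : category) (F : A -> B).
Variable Fhom : forall X Y : A, hom X Y -> hom (F X) (F Y).
Hypothesis Fid : forall X, Fhom (idm X) = idm (F X).
Hypothesis Fcomp : forall X Y Z (g : hom Y Z) (f : hom X Y),
  Fhom (mcomp g f) = mcomp (Fhom g) (Fhom f).
Hypothesis Ffaithful : forall X Y (f g : hom X Y), Fhom f = Fhom g -> f = g.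
Hypothesis Ffull : forall X Y (f : hom (F X) (F Y)), exists g, Fhom g = f.
Hypothesis Fker : forall (M N : A) (f : hom M N), exists (K : A) (i : hom K M),
  is_kernel f i /\ is_kernel (Fhom f) (Fhom i).

Lemma fully_faithful_split_mono (X Y : A) (i : hom X Y) :
  split_mono (Fhom i) <-> split_mono i.
Proof.
split=> [[r ri]|[r ri]]; last by exists (Fhom r); rewrite -Fcomp ri.
have [s sr] := Ffull r; exists s.
by apply: Ffaithful; rewrite Fcomp sr ri Fid.
Qed.

Lemma fully_faithful_rickart (M N : A) : rickart M N <-> rickart (F M) (F N).
Proof.
split=> rMN f.
  have [g <-] := Ffull f; have [K [i [iK FiK]]] := Fker g.
  have [K' [j [jK js]]] := rMN g.
  exists (F K), (Fhom i); split=> //.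
  by apply/fully_faithful_split_mono/(kernel_split_mono jK iK js).
have [K [i [iK FiK]]] := Fker f; have [K' [j [jK js]]] := rMN (Fhom f).
exists K, i; split=> //.
by apply/fully_faithful_split_mono/(kernel_split_mono jK FiK js).
Qed.

End FullyFaithful.

(** A cokernel is, by conversion, a kernel in the opposite category, and a split
    epimorphism a split monomorphism: this reduces the dual notion to the first
    one. *)
Definition op_category (A : category) : category :=
  @Category A (fun X Y => hom Y X) (@idm A)
    (fun X Y Z g f => mcomp f g) (fun X Y => zerom Y X)
    (fun X Y Z T h g f => esym (compA f g h))
    (fun X Y f => compm1 f) (fun X Y f => comp1m f)
    (fun X Y Z f => compm0 Z f) (fun X Y Z f => comp0m X f).

(** * Linear algebra over a field *)

(** A linear s with f s f = f amounts to a choice of complements of Ker f and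
    Im f. Zorn's lemma is applied to the graphs of partial linear maps
    from V to U which are sections of f over Im f; a maximal one is total. *)
Lemma linear_pseudo_inverse (k : fieldType) (U V : lmodType k)
    (f : {linear U -> V}) :
  exists s : {linear V -> U}, forall u, f (s (f u)) = f u.
Proof.
pose T : Type := (V * U)%type.
pose good (G : set T) :=
  [/\ forall a x y, G x -> G y -> G (a *: x + y),
      forall u, G (0, u) -> u = 0 &
      forall u u', G (f u, u') -> f u' = f u].
have [F sF tF|G [[Glin Gfun Gsec] Gmax]] := @Zorn_bigcup T good.
  split=> [a x y [X FX Xx] [Y FY Yy]|u [X FX Xu]|u u' [X FX Xu]].
  - have [XY|YX] := tF X Y FX FY.
      by exists Y => //; case: (sF Y FY) => lin _ _; apply: lin => //;
        apply: XY.
    by exists X => //; case: (sF X FX) => lin _ _; apply: lin => //; apply: YX.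
  - by case: (sF X FX) => _ + _; apply.
  - by case: (sF X FX) => _ _; apply.
have GM (B : set T) : good B -> (G `<=` B)%classic -> (B `<=` G)%classic.
  by move=> gB GB; apply: contrapT => BG; apply: (Gmax B).
(* Zorn's lemma could a priori return the empty relation. *)
have G0 : G 0.
  apply: contrapT => nG0.
  have Ge x : ~ G x.
    by move=> Gx; have := Glin (-1) x x Gx Gx; rewrite scaleN1r addNr.
  apply/nG0/(GM (fun x => x = 0)) => //; last by move=> x /Ge.
  split=> [a x y -> ->|u [] //|u u' [-> ->]]; last by rewrite linear0.
  by rewrite scaler0 addr0.
have GZ a x : G x -> G (a *: x).
  by move=> Gx; rewrite -[_ *: _]addr0; apply: Glin.
have GB x y : G x -> G y -> G (x - y).
  by move=> Gx Gy; rewrite -scaleN1r addrC; apply: Glin.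
have Gdom v : exists u, G (v, u).
  apply: contrapT => nGv.
  have nGZ a g u : a *: v = g -> G (g, u) -> a = 0.
    move=> av Gg; apply: contrapT => /eqP a0; apply: nGv; exists (a^-1 *: u).
    by have := GZ a^-1 _ Gg; rewrite -av -[_ *: (_, _)]/(_, _) /= scalerK.
  (* The graph G extends to v by the value u0 as soon as this does not violate
     the section condition at the new elements of Im f. *)
  suff [u0 u0P] : exists u0, forall a g u w,
      G (g, u) -> f w = g + a *: v -> f (u + a *: u0) = f w.
    apply: nGv; exists u0.
    apply: (GM (fun x => exists a g, G g /\ x = g + a *: (v, u0))).
    - split=> [a _ _ [b [x [Gx ->]]] [c [y [Gy ->]]]|u|u u'].
      + exists (a * b + c), (a *: x + y); split; first exact: Glin.
        by rewrite scalerDr scalerA addrACA scalerDl.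
      + move=> [a [[g e] [Gg [/esym/eqP + ->]]]].
        rewrite addrC addr_eq0 => /eqP av.
        have a0 : a = 0.
          apply: (nGZ a _ _ av).
          by have := GZ (-1) _ Gg; rewrite scaleN1r; apply.
        rewrite a0 scale0r addr0; apply: Gfun.
        move: av; rewrite a0 scale0r => /esym/eqP.
        by rewrite oppr_eq0 => /eqP <-.
      + by move=> [a [[g e] [Gg [fu ->]]]]; apply: u0P Gg fu.
    - by move=> x Gx; exists 0, x; rewrite scale0r addr0.
    - by exists 1, 0; rewrite scale1r add0r.
  (* If v = d + f u1 with d in the domain, the value is forced modulo Ker f;
     otherwise no new element of Im f enters the domain and 0 will do. *)
  have [[d [e [u1 [Gd vE]]]]|nd] :=
      pselect (exists d e u1, G (d, e) /\ v = d + f u1).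
    exists (e + u1) => a g u w Gg; rewrite vE scalerDr addrA => fw.
    have : f (w - a *: u1) = g + a *: d by rewrite linearB linearZ fw addrK.
    have := Glin a _ _ Gd Gg.
    rewrite -[_ + _]/(_, _) /= addrC [a *: e + u]addrC => + E.
    rewrite -E => /Gsec fue.
    by rewrite scalerDr addrA linearD fue -linearD subrK.
  exists 0 => a g u w Gg fw; have [a0|a0] := eqVneq a 0.
    move: fw Gg; rewrite a0 !scale0r !addr0 => <-; exact: Gsec.
  case: nd; exists (- (a^-1 *: g)), (- (a^-1 *: u)), (a^-1 *: w); split.
    by have := GZ (- a^-1) _ Gg; rewrite scaleNr; apply.
  by rewrite [f _]linearZ /= fw scalerDr scalerK // addKr.
have [s Gs] := choice Gdom.
have slin : linear s.
  move=> a x y; apply/eqP; rewrite -subr_eq0; apply/eqP/Gfun.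
  suff -> : (0, s (a *: x + y) - (a *: s x + s y)) =
    (a *: x + y, s (a *: x + y)) - (a *: (x, s x) + (y, s y)) :> T.
    by apply: GB => //; apply: Glin.
  by congr (_, _); rewrite /= subrr.
pose sL : {linear V -> U} := HB.pack s (GRing.isLinear.Build k V U *:%R s slin).
by exists sL => u; apply: Gsec.
Qed.

Lemma scalar_scale_bilinear (k : fieldType) (U V : lmodType k)
    (phi : {scalar U}) :
  bilinear_for *:%R *:%R (fun x (y : V) => phi x *: y).
Proof.
split=> [y|x] a u v /=; first by rewrite linearP scalerDl scalerA.
by rewrite scalerDr !scalerA mulrC.
Qed.

Definition tensor_linl (k : fieldType) (U V : lmodType k) (v : V) :
    {linear U -> tens U V} :=
  HB.pack (fun u => tensor u v)
    (GRing.isLinear.Build k U (tens U V) *:%R _ ((tensor_bilinear U V).1 v)).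

Definition tensor_linr (k : fieldType) (U V : lmodType k) (u : U) :
    {linear V -> tens U V} :=
  HB.pack (tensor u)
    (GRing.isLinear.Build k V (tens U V) *:%R _ ((tensor_bilinear U V).2 u)).

(** Write t = sum_i x_i (x) y_i and let A : k^n -> U be the linear map sending
    the i-th basis vector to x_i. The coordinates phi_j of a pseudo-inverse of
    A satisfy x_i = sum_j phi_j(x_i) x_j, so t = sum_j x_j (x) (sum_i phi_j(x_i)
    y_i), where the right factors are the contractions of t by the phi_j. *)
Lemma tens_contract_eq0 (k : fieldType) (U V : lmodType k) (t : tens U V) :
  (forall phi : {scalar U}, tens_lift (fun x y => phi x *: y) t = 0) -> t = 0.
Proof.
rewrite -[t]tens_pi_repr; move: (repr t) => s {t} phi0.
pose x (i : 'I_(size s)) := (nth (0, 0) s i).1.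
pose y (i : 'I_(size s)) := (nth (0, 0) s i).2.
pose A (a : 'rV[k]_(size s)) := \sum_i a 0 i *: x i.
have Alin : linear A.
  move=> a u v; rewrite /A scaler_sumr -big_split /=; apply: eq_bigr => i _.
  by rewrite !mxE scalerDl scalerA.
pose AL : {linear 'rV[k]_(size s) -> U} :=
  HB.pack A (GRing.isLinear.Build k _ U *:%R A Alin).
have [S ASA] := linear_pseudo_inverse AL.
have phi_lin j : linear_for *%R (fun u => S u 0 j).
  by move=> a u v; rewrite linearP !mxE.
pose phi j : {scalar U} :=
  HB.pack (fun u => S u 0 j) (GRing.isLinear.Build k U k *%R _ (phi_lin j)).
have xE i : x i = \sum_j phi j (x i) *: x j.
  have Ai : A (delta_mx 0 i) = x i.
    rewrite /A (bigD1 i) //= mxE !eqxx scale1r big1 ?addr0 // => j ji.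
    by rewrite mxE (negPf ji) andbF scale0r.
  by rewrite -{1}Ai -[LHS]ASA /= Ai.
have y0 j : \sum_i phi j (x i) *: y i = 0.
  rewrite -[RHS](phi0 (phi j)) (tens_lift_pi (scalar_scale_bilinear V (phi j))).
  by rewrite (big_nth (0, 0)) big_mkord.
rewrite tens_pi_sum (big_nth (0, 0)) big_mkord.
transitivity (\sum_i \sum_j phi j (x i) *: tensor (x j) (y i)).
  apply: eq_bigr => i _; rewrite -/(x i) -/(y i) {1}xE.
  rewrite -[LHS]/(tensor_linl U (y i) _) linear_sum; apply: eq_bigr => j _.
  exact: linearZ.
rewrite exchange_big big1 //= => j _.
rewrite -[RHS](linear0 (tensor_linr V (x j))) -(y0 j) linear_sum.
by apply: eq_bigr => i _; rewrite linearZ.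
Qed.

(** * The functor C (x) - *)

Section TensorFunctor.
Variables (k : fieldType) (C : lmodType k).

Definition tens_mapr (U V : lmodType k) (g : {linear U -> V}) :
    {linear tens C U -> tens C V} :=
  tens_lift_lin (tens_map_bilinear idfun g).

Lemma tens_mapr_comp (U V W : lmodType k) (g : {linear V -> W})
    (f : {linear U -> V}) t :
  tens_map idfun g (tens_map idfun f t) = tens_map idfun (g \o f) t :> tens C W.
Proof.
rewrite [LHS](tens_map_sweedler f (tens_mapr g)).
by apply: tens_lift_ext => x y; exact: tens_map_tensor.
Qed.

Lemma tens_assoc_mapr (D : {linear C -> tens C C}) (U V : lmodType k)
    (g : {linear U -> V}) t :
  tens_assoc (tens_map D idfun (tens_map idfun g t)) =
  tens_map idfun (tens_map idfun g) (tens_assoc (tens_map D idfun t)).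
Proof.
pose A W := tens_lift_lin (@tens_assoc_bilinear k C C W).
pose DD (W : lmodType k) := tens_lift_lin (tens_map_bilinear D
  (idfun : {linear W -> W})).
pose L := A V \o DD V \o tens_mapr g.
pose R := tens_mapr (tens_mapr g) \o (A U \o DD U).
apply: (@tens_ext k C U _ L R) => x y.
have DDt W z w : DD W (tensor z w) = tensor (D z) w.
  exact: (tens_map_tensor D idfun).
have At W z w : A W (tensor z w) =
    tens_lift (fun x y => tensor x (tensor y w)) z.
  exact: (tens_lift_tensor (@tens_assoc_bilinear k C C W)).
have gt (W W' : lmodType k) (h : {linear W -> W'}) z w :
    tens_mapr h (tensor z w) = tensor z (h w).
  exact: (tens_map_tensor idfun h).
rewrite -[LHS]/(A V (DD V (tens_mapr g (tensor x y)))) gt.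
rewrite -[RHS]/(tens_mapr (tens_mapr g) (A U (DD U (tensor x y)))).
rewrite !DDt !At linear_tens_lift.
by apply: tens_lift_ext => u v; rewrite !gt.
Qed.

Lemma tens_contract_mapr (U V : lmodType k) (g : {linear U -> V})
    (phi : {scalar C}) t :
  tens_lift (fun x y => phi x *: y) (tens_map idfun g t) =
  g (tens_lift (fun x y => phi x *: y) t).
Proof.
pose L := tens_lift_lin (scalar_scale_bilinear V phi).
rewrite [LHS](tens_map_sweedler g L).
rewrite [RHS]linear_tens_lift; apply: tens_lift_ext => x y.
rewrite [LHS](tens_lift_tensor (scalar_scale_bilinear V phi)) /=.
by rewrite linearZ.
Qed.

End TensorFunctor.

(** * The kernel of a linear map as a module *)

Section KernelSpace.
Variables (R : pzRingType) (V W : lmodType R) (f : {linear V -> W}).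

Definition ker_pred : pred V := fun v => f v == 0.

Fact ker_pred_submod : submod_closed ker_pred.
Proof.
split=> [|a u v]; rewrite !unfold_in /ker_pred ?linear0 //.
by move=> /eqP fu /eqP fv; rewrite linearP fu fv scaler0 addr0.
Qed.
HB.instance Definition _ :=
  GRing.isSubmodClosed.Build R V ker_pred ker_pred_submod.

Record ker_space := KerSpace { ker_val :> V; ker_valP : ker_val \in ker_pred }.
HB.instance Definition _ := [isSub for ker_val].
HB.instance Definition _ := [Choice of ker_space by <:].
HB.instance Definition _ := [SubChoice_isSubLmodule of ker_space by <:].

Definition ker_incl : {linear ker_space -> V} := \val.

Lemma ker_inclP x : f (ker_incl x) = 0.
Proof. by case: x => v /= /eqP. Qed.

Section Corestriction.
Variables (X : lmodType R) (g : {linear X -> V}).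
Hypothesis fg0 : forall x, f (g x) = 0.

Fact ker_corestr_subproof x : g x \in ker_pred.
Proof. exact/eqP. Qed.

Definition ker_corestr_fun x := KerSpace (ker_corestr_subproof x).

Fact ker_corestr_linear : linear ker_corestr_fun.
Proof. by move=> a x y; apply: val_inj; rewrite /= linearP. Qed.

Definition ker_corestr : {linear X -> ker_space} :=
  HB.pack ker_corestr_fun
    (GRing.isLinear.Build R X ker_space *:%R _ ker_corestr_linear).

End Corestriction.
End KernelSpace.

(** * Kernels and cokernels of colinear maps *)

Section Retract.
Variables (k : fieldType) (C : coalgebra k) (M : comodule C) (K : lmodType k).
Variables (i : {linear K -> M}) (p : {linear M -> K}).

Definition retract_coact : {linear K -> tens C K} :=
  tens_mapr C p \o (coact M \o i).

Hypothesis pK : forall x, p (i x) = x.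
Hypothesis retract_stable : forall x,
  tens_map idfun (retract_coact \o p) (coact M (i x)) =
  tens_map idfun (tens_mapr C p \o coact M) (coact M (i x)).

Fact retract_coact_assoc x :
  tens_assoc (tens_map (comul C) idfun (retract_coact x)) =
  tens_map idfun retract_coact (retract_coact x).
Proof.
rewrite [RHS](tens_mapr_comp retract_coact p) retract_stable.
rewrite [LHS](tens_assoc_mapr _ p) coact_assoc.
exact: (tens_mapr_comp (tens_mapr C p) (coact M)).
Qed.

Fact retract_coact_counit x :
  tens_lift (fun c y => counit C c *: y) (retract_coact x) = x.
Proof. by rewrite [LHS](tens_contract_mapr p) coact_counit. Qed.

(** Both a subcomodule and a quotient comodule of M arise here: the stability
    hypothesis holds when C (x) (i p) fixes the image of rho i, where rho is the
    coaction of M, and also when the coaction of K composed with p is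
    (C (x) p) rho. *)
Definition retract_comodule : comodule C :=
  Comodule retract_coact_assoc retract_coact_counit.

End Retract.

Section Exactness.
Variables (k : fieldType) (C : coalgebra k) (M N : comodule C).
Variable f : comod_hom M N.

(** The coaction of M maps Ker f into C (x) Ker f: C (x) (1 - s f) fixes rho m
    if f m = 0, because (C (x) f) (rho m) = rho (f m) = 0. *)
Lemma comod_hom_ker :
  exists (K : comodule C) (i : comod_hom K M) (p : {linear M -> K}),
  [/\ forall x, p (i x) = x, forall x, f (i x) = 0 &
      forall m, f m = 0 -> i (p m) = m].
Proof.
have [s fsf] := linear_pseudo_inverse f.
pose e : {linear M -> M} := idfun \- (s \o f).
have fe m : f (e m) = 0 by rewrite /= linearB /= fsf subrr.
pose i := ker_incl f; pose p := ker_corestr fe.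
have ipE m : f m = 0 -> i (p m) = m.
  by move=> fm; rewrite /= fm linear0 subr0.
have iK x : p (i x) = x by apply: val_inj; apply: ipE; exact: ker_inclP.
have sub x : tens_map idfun (i \o p) (coact M (i x)) = coact M (i x).
  rewrite -[RHS]subr0.
  have <- : tens_map idfun s (tens_map idfun f (coact M (i x))) = 0.
    rewrite -comod_mapP ker_inclP linear0.
    exact: (linear0 (tens_mapr C s)).
  rewrite (tens_mapr_comp s f) -[X in X - _]tens_lift_id.
  rewrite /tens_map /tens_lift -sumrB; apply: eq_bigr => -[c m] _ /=.
  exact: (linearB (tensor_linr M c)).
have stable x :
    tens_map idfun (retract_coact i p \o p) (coact M (i x)) =
    tens_map idfun (tens_mapr C p \o coact M) (coact M (i x)).
  rewrite -[in RHS]sub.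
  by rewrite [RHS](tens_mapr_comp (tens_mapr C p \o coact M) (i \o p)).
pose K := retract_comodule iK stable.
have ih x : coact M (i x) = tens_map idfun i (coact K x).
  by rewrite [RHS](tens_mapr_comp i p) sub.
exists K, (@ComodHom k C K M i ih), p; split=> //; exact: ker_inclP.
Qed.

(** The space Ker (f s) is a complement of Im f, onto which q = 1 - f s
    projects, so it is a model of N / Im f. The map (C (x) q) rho factors
    through q since it kills Im f: (C (x) q) (rho (f m)) = (C (x) q f) (rho m).
    *)
Lemma comod_hom_coker :
  exists (Q : comodule C) (q : comod_hom N Q) (j : {linear Q -> N})
         (s : N -> M),
  [/\ forall x, q (j x) = x, forall m, q (f m) = 0 &
      forall y, j (q y) = y - f (s y)].
Proof.
have [s fsf] := linear_pseudo_inverse f.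
pose g : {linear N -> N} := f \o s; pose e : {linear N -> N} := idfun \- g.
have ge y : g (e y) = 0 by rewrite /= linearB /= linearB /= fsf subrr.
pose j := ker_incl g; pose q := ker_corestr ge.
have jqE y : j (q y) = y - f (s y) by [].
have qf m : q (f m) = 0 by apply: val_inj; rewrite /= fsf subrr.
have gj x : f (s (j x)) = 0 by exact: (@ker_inclP _ _ _ g x).
have jK x : q (j x) = x.
  by apply: val_inj; rewrite -[LHS]/(j (q (j x))) jqE gj subr0.
have quot y : retract_coact j q (q y) = tens_map idfun q (coact N y).
  rewrite -[LHS]/(tens_map idfun q (coact N (j (q y)))) jqE linearB.
  rewrite [LHS](linearB (tens_mapr C q)) comod_mapP /=.
  rewrite (_ : tens_lift _ (tens_map _ _ _) = 0) ?subr0 //.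
  rewrite [LHS](tens_mapr_comp q f) /tens_map /tens_lift.
  rewrite big1 //= => -[c m] _ /=.
  exact: etrans (congr1 (tensor c) (qf m)) (linear0 (tensor_linr _ c)).
have stable x :
    tens_map idfun (retract_coact j q \o q) (coact N (j x)) =
    tens_map idfun (tens_mapr C q \o coact N) (coact N (j x)).
  by apply: tens_lift_ext => c y; rewrite [X in tensor c X]quot.
pose Q := retract_comodule jK stable.
have qh y : coact Q (q y) = tens_map idfun q (coact N y) by exact: quot.
by exists Q, (@ComodHom k C N Q q qh), j, s.
Qed.

End Exactness.

(** * The functor from comodules to rational modules *)

Section RationalFunctor.
Variables (k : fieldType) (C : coalgebra k).

Lemma rat_hom_linear (M N : comodule C) (f : comod_hom M N) :
  linear (f : rat_module M -> rat_module N).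
Proof.
move=> a x y; rewrite [LHS]linearD; congr (_ + _).
rewrite -[LHS]/(f (dual_act x a)) -[RHS]/(dual_act (f x) a) /dual_act.
by rewrite comod_mapP [RHS](tens_contract_mapr f).
Qed.

Definition rat_hom (M N : comodule C) (f : comod_hom M N) :
    {linear rat_module M -> rat_module N} :=
  HB.pack (f : rat_module M -> rat_module N)
    (GRing.isLinear.Build (dual_algebra C)^c (rat_module M) (rat_module N) *:%R
       _ (rat_hom_linear f)).

Fact scaled_counit_linear (a : k) :
  linear_for *%R (fun c : C => a * counit C c).
Proof. by move=> b x y; rewrite linearP mulrDr mulrCA. Qed.

(** The scalars of k act on a rational module through multiples of the counit,
    so that C^*-linear maps are k-linear. *)
Lemma dual_act_counit (M : comodule C) (a : k) (m : M) :
  dual_act m (dual_pack (scaled_counit_linear a)) = a *: m.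
Proof.
rewrite -[in RHS](coact_counit m) /dual_act /tens_lift scaler_sumr.
by apply: eq_bigr => p _; rewrite scalerA.
Qed.

(** Contracted by phi, the colinearity of g at m becomes
    g (m . phi) = (g m) . phi. *)
Lemma rat_hom_full (M N : comodule C)
    (g : {linear rat_module M -> rat_module N}) :
  exists f : comod_hom M N, rat_hom f = g.
Proof.
have gact m phi : g (dual_act m phi) = dual_act (g m) phi.
  exact: (linearZZ g (phi : (dual_algebra C)^c) m).
have glin : linear (g : M -> N).
  move=> a x y; rewrite [LHS](linearD g); congr (_ + _).
  by rewrite -!dual_act_counit gact.
pose gL : {linear M -> N} := HB.pack (g : M -> N)
  (GRing.isLinear.Build k M N *:%R _ glin).
have gP m : coact N (gL m) = tens_map idfun gL (coact M m).
  apply/eqP; rewrite -subr_eq0; apply/eqP/tens_contract_eq0 => phi.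
  pose L := tens_lift_lin (scalar_scale_bilinear N phi).
  rewrite -[LHS]/(L _) linearB [L (tens_map _ _ _)]tens_contract_mapr.
  by apply/eqP; rewrite subr_eq0; apply/eqP; symmetry; exact: gact.
by exists (ComodHom gP); apply: linear_eq.
Qed.

(** A map g with f g = 0 factors through i only as p g. That p g is again a
    morphism follows from i p g = g, as i is a morphism with left inverse p;
    this holds also when the source of g is a module which is not rational. *)
Lemma rat_hom_ker (M N : comodule C) (f : comod_hom M N) :
  exists (K : comodule C) (i : comod_hom K M),
    @is_kernel (comod_category C) M N K f i /\
    @is_kernel (rmod_category (dual_algebra C)) _ _ _ (rat_hom f) (rat_hom i).
Proof.
have [K [i [p [iK fi ipE]]]] := comod_hom_ker f.
have i_inj : injective i by exact: can_inj iK.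
exists K, i; split; split.
- exact: comod_hom_eq.
- move=> X g /(congr1 (fun h : comod_hom X N => h : X -> N)) fg.
  have ipg x : i (p (g x)) = g x by apply: ipE; exact: (congr1 (@^~ x) fg).
  have hP x : coact K ((p \o g) x) = tens_map idfun (p \o g) (coact X x).
    rewrite -(tens_mapr_comp p g) -comod_mapP /= -[in RHS]ipg comod_mapP.
    rewrite [RHS](tens_mapr_comp p i).
    rewrite -[LHS]tens_lift_id; apply: tens_lift_ext => c y /=.
    by rewrite iK.
  exists (ComodHom hP); split; first exact: comod_hom_eq.
  by move=> h ih; apply: comod_hom_eq => x; apply: i_inj; rewrite /= ipg -ih.
- exact: linear_eq.
- move=> X g /(congr1 (fun h : {linear X -> rat_module N} => h : X -> N)) fg.
  have ipg x : i (p (g x)) = g x by apply: ipE; exact: (congr1 (@^~ x) fg).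
  have hlin : linear (fun x : X => p (g x) : rat_module K).
    move=> a x y; apply: i_inj; rewrite ipg [LHS]linearP.
    by rewrite -[RHS]/(rat_hom i _) [RHS]linearP /= !ipg.
  pose h : {linear X -> rat_module K} :=
    HB.pack (fun x : X => p (g x) : rat_module K)
      (GRing.isLinear.Build (dual_algebra C)^c X (rat_module K) *:%R _ hlin).
  exists h; split; first exact: linear_eq.
  by move=> h' ih; apply: linear_eq => x; apply: i_inj; rewrite /= ipg -ih.
Qed.

(** A map g with g f = 0 factors through q only as g j; it is a morphism since
    g j q = g, where q is a morphism with section j. *)
Lemma rat_hom_coker (M N : comodule C) (f : comod_hom M N) :
  exists (Q : comodule C) (q : comod_hom N Q),
    @is_cokernel (comod_category C) M N Q f q /\
    @is_cokernel (rmod_category (dual_algebra C)) _ _ _ (rat_hom f) (rat_hom q).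
Proof.
have [Q [q [j [s [jK qf jqE]]]]] := comod_hom_coker f.
exists Q, q; split; split.
- exact: comod_hom_eq.
- move=> X g /(congr1 (fun h : comod_hom M X => h : M -> X)) gf.
  have gf0 y : g (f y) = 0 by exact: (congr1 (@^~ y) gf).
  have gjq y : g (j (q y)) = g y by rewrite jqE linearB gf0 subr0.
  have hP x : coact X ((g \o j) x) = tens_map idfun (g \o j) (coact Q x).
    rewrite -{2}[x]jK comod_mapP /= comod_mapP.
    rewrite [RHS](tens_mapr_comp (g \o j) q); apply: tens_lift_ext => c y /=.
    by rewrite gjq.
  exists (ComodHom hP); split; first exact: comod_hom_eq.
  by move=> h hq; apply: comod_hom_eq => x; rewrite /= -hq /= jK.
- exact: linear_eq.
- move=> X g /(congr1 (fun h : {linear rat_module M -> X} => h : M -> X)) gf.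
  have gf0 y : g (f y) = 0 by exact: (congr1 (@^~ y) gf).
  have gjq y : g (j (q y)) = g y by rewrite jqE [LHS](linearB g) gf0 subr0.
  have hlin : linear (fun x : rat_module Q => g (j x)).
    move=> a x y; rewrite -[x in LHS]jK -[y in LHS]jK.
    by rewrite -[_ + _ in LHS](linearP (rat_hom q)) gjq linearP.
  pose h : {linear rat_module Q -> X} :=
    HB.pack (fun x : rat_module Q => g (j x))
      (GRing.isLinear.Build (dual_algebra C)^c (rat_module Q) X *:%R _ hlin).
  exists h; split; first exact: linear_eq.
  by move=> h' hq; apply: linear_eq => x; rewrite /= -hq /= jK.
Qed.

End RationalFunctor.

Theorem corollary2p8 (k : fieldType) (C : coalgebra k) (M N : comodule C) :
  (@rickart (comod_category C) M N <->
   @rickart (rmod_category (dual_algebra C)) (rat_module M) (rat_module N)) /\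
  (@dual_rickart (comod_category C) M N <->
   @dual_rickart (rmod_category (dual_algebra C)) (rat_module M) (rat_module N)).
Proof.
have faithful (X Y : comodule C) (f g : comod_hom X Y) :
    rat_hom f = rat_hom g -> f = g.
  by move=> fg; apply: comod_hom_eq => x; rewrite -[LHS]/(rat_hom f x) fg.
split.
  apply: (@fully_faithful_rickart (comod_category C)
    (rmod_category (dual_algebra C)) (@rat_module k C) (@rat_hom k C)) => //.
  - by move=> X; apply: linear_eq.
  - by move=> X Y Z g f; apply: linear_eq.
  - exact: rat_hom_full.
  - exact: rat_hom_ker.
(* N is dual M-Rickart when M is N-Rickart in the opposite category. *)
apply: (@fully_faithful_rickart (op_category (comod_category C))
  (op_category (rmod_category (dual_algebra C))) (@rat_module k C)
  (fun X Y => @rat_hom k C Y X)) => //.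
- by move=> X; apply: linear_eq.
- by move=> X Y Z g f; apply: linear_eq.
- by move=> X Y; apply: faithful.
- by move=> X Y; apply: rat_hom_full.
- by move=> X Y; apply: rat_hom_coker.
Qed.
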